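(* Let $T=(T_1,\dots,T_d)$ be a contractive tuple on $H$ with $0<\Delta_T<\infty$. If $T$ is pure, then $\Delta_{T^n}<\Delta_{T^{n+1}}$ for all $n\ge1$.
   Context: Fix a positive integer $d$ and a complex, separable, infinite dimensional Hilbert space $H$. A $d$-tuple $T=(T_1,\dots,T_d)$ of bounded operators on $H$ (not assumed to commute) is contractive if $T_1T_1^*+\cdots+T_dT_d^*\le I$. Put $P_T(X)=\sum_{i=1}^d T_iXT_i^*$ for $X\in\mathcal B(H)$, and let $P_T^n$ be the $n$-fold iterate of $P_T$. The sequence $P_T^n(I)$ is decreasing and has a strong limit; $T$ is called pure if this limit is $0$. For $n\ge1$, $T^n$ denotes the $d^n$-tuple of all products $T_{i_1}T_{i_2}\cdots T_{i_n}$, $1\le i_1,\dots,i_n\le d$ (so $P_{T^n}(I)=P_T^n(I)$). The $n$-th defect space is $H_n=\overline{\mathrm{Range}}\,(I-P_T^n(I))$ and the $n$-th defect dimension is $\Delta_{T^n}=\dim H_n$; in particular $\Delta_T=\dim H_1$. *)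

(* Defs.v *)
From HB Require Import structures.
From mathcomp Require Import all_boot all_order all_algebra.
From mathcomp Require Import complex.
From mathcomp Require Import all_classical all_reals all_analysis.

Set Implicit Arguments.
Unset Strict Implicit.
Unset Printing Implicit Defensive.

Import Order.TTheory GRing.Theory Num.Theory.
Import numFieldNormedType.Exports.

Local Open Scope classical_set_scope.
Local Open Scope complex_scope.
Local Open Scope ring_scope.

Section Hilbert.
Context {R : realType} {H : completeNormedModType R[i]}.
Variable dot : {dot H for Num.conj}.

(* [dot] is linear in its first argument and conjugate-linear in the second.
   [H] is complete for the norm [`|_|], so that [H] with [dot] is a Hilbert
   space exactly when that norm is the one induced by [dot]. *)
Definition induces_norm := forall x : H, `|x| ^+ 2 = dot x x.

Definition separable_space := exists2 D : set H, countable D & dense D.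

Definition lin_span (B : set H) : set H :=
  [set x | exists2 s : seq (R[i] * H), (forall p, p \in s -> B p.2) &
           x = \sum_(p <- s) p.1 *: p.2].

Definition orthonormal_set (B : set H) :=
  forall x y : H, B x -> B y -> dot x y = (x == y)%:R.

Definition orthonormal_basis (V B : set H) :=
  orthonormal_set B /\ closure (lin_span B) = V.

(* Meant for closed subspaces [V], which always have an orthonormal basis; all
   of them have the same cardinality.  The dimension takes values in
   [0, 1, 2, ..., +oo]: [counting B] is the number of elements of [B], or
   [+oo] if [B] is infinite, and in a separable space infinite orthonormal
   bases are countable. *)
Definition hdim (V : set H) : \bar R :=
  counting (xget set0 (orthonormal_basis V)).

Definition bounded_op (A : H -> H) :=
  exists M : R, forall x, `|A x| <= M%:C * `|x|.

(* For [A] linear and bounded there is exactly one such function, and it is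
   again linear and bounded (Riesz). *)
Definition adjoint (A : H -> H) : H -> H :=
  xget (fun=> 0) [set B : H -> H | forall x y, dot (A x) y = dot x (B y)].

(* In [R[i]], [a <= b] says that [b - a] is real and nonnegative. *)
Definition op_le (A B : H -> H) := forall x, 0 <= dot (B x - A x) x.

Section Tuple.
Context {d : nat}.
Variable T : 'I_d -> {linear H -> H}.

Definition tuple_map (X : H -> H) : H -> H :=
  fun x => \sum_(i < d) T i (X (adjoint (T i) x)).

Definition tuple_iter (n : nat) : H -> H := iter n tuple_map idfun.

Definition contractive := op_le (tuple_map idfun) idfun.

Definition pure :=
  forall x : H, tuple_iter n x @[n --> \oo] --> (0 : H).

Definition defect_space (n : nat) : set H :=
  closure (range (fun x => x - tuple_iter n x)).

Definition defect_dim (n : nat) : \bar R := hdim (defect_space n).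

End Tuple.
End Hilbert.

(* Main.v *)
Require Import Defs.
From HB Require Import structures.
From mathcomp Require Import all_boot all_order all_algebra.
From mathcomp Require Import complex.
From mathcomp Require Import all_classical all_reals all_analysis.
From mathcomp Require Import finmap ring.

(** Write [D_n = I - P_T^n (I)] and let [R_n] be the range of [D_n], so that the
    [n]-th defect space is the closure of [R_n].

    From [D_(n+1) = D_1 + \sum_i T_i D_n T_i^*] every [D_n] is symmetric and
    positive, and it has finite rank because [D_1] does.  A subspace of finite
    dimension is closed, so the defect spaces are the [R_n] themselves
    ([closed_defect]) and the defect dimensions are ordinary finite dimensions.

    The heart of the proof is the identity [R_(n+1) = R_1 + \sum_i T_i R_n].
    The inclusion from left to right is read off the recursion
    ([defectS_sub]).  For the other one, the range of a symmetric operator of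
    finite rank is the orthogonal complement of its kernel
    ([range_symmetric]), and a vector killed by the sum [D_(n+1)] of positive
    operators is killed by each of them ([defect_op_eq0]); hence it is
    orthogonal to [R_1] and to each [T_i R_n] ([defect1_sub],
    [defect_T_sub]).

    The identity makes [R_n] increase with [n] ([defect_mono]) and shows that
    the chain is frozen as soon as two consecutive terms agree
    ([defect_stationary]).  If the [n]-th and the [(n+1)]-st dimensions were
    equal, then [R_n = R_(n+1)], so [R_n] would contain every vector [D_m x].
    Purity says that [D_m x] tends to [x]; as [R_n] is closed it would be all of
    [H] ([pure_stationary]), which has infinite dimension.

    The dimension enters through orthonormal families only.  An orthonormal
    family inside a span of [m] vectors has at most [m] elements
    ([orthonormal_size]), whence any two orthonormal bases have the same size
    ([hdim_lin_span]) and proper subspaces have smaller dimension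
    ([hdim_ltP]). *)

Set Implicit Arguments.
Unset Strict Implicit.
Unset Printing Implicit Defensive.

Import Order.TTheory GRing.Theory Num.Theory.
Import numFieldNormedType.Exports.

Local Open Scope classical_set_scope.
Local Open Scope complex_scope.
Local Open Scope ring_scope.

(** * Subspaces and linear spans *)

Section LinearSpan.
Context {R : realType} {H : completeNormedModType R[i]}.
Implicit Types (V B : set H) (s t : seq H).

Definition subspace V := V 0 /\ forall a x y, V x -> V y -> V (a *: x + y).

Lemma subspaceD V x y : subspace V -> V x -> V y -> V (x + y).
Proof. by move=> [_ cV] Vx Vy; rewrite -[x]scale1r; apply: cV. Qed.

Lemma subspaceZ V a x : subspace V -> V x -> V (a *: x).
Proof. by move=> [V0 cV] Vx; rewrite -[_ *: _]addr0; apply: cV. Qed.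

Lemma subspaceB V x y : subspace V -> V x -> V y -> V (x - y).
Proof.
by move=> sV Vx Vy; apply: subspaceD => //; rewrite -scaleN1r; apply: subspaceZ.
Qed.

Lemma subspace_sum V (I : eqType) (r : seq I) (F : I -> H) :
  subspace V -> (forall i, i \in r -> V (F i)) -> V (\sum_(i <- r) F i).
Proof.
move=> sV VF; rewrite big_seq; elim/big_ind: _ => //; first exact: sV.1.
by move=> x y; apply: subspaceD.
Qed.

Lemma lin_span_min V B : subspace V -> B `<=` V -> lin_span B `<=` V.
Proof.
move=> sV BV _ [s sB ->]; apply: subspace_sum => // p /sB/BV.
exact: subspaceZ.
Qed.

Lemma subset_lin_span B : B `<=` lin_span B.
Proof.
move=> x Bx; exists [:: (1, x)]; first by move=> p; rewrite inE => /eqP ->.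
by rewrite big_seq1 scale1r.
Qed.

Lemma subspace_lin_span B : subspace (lin_span B).
Proof.
split; first by exists [::]; rewrite ?big_nil.
move=> a _ _ [s sB ->] [t tB ->].
exists ([seq (a * p.1, p.2) | p <- s] ++ t).
  by move=> p; rewrite mem_cat => /orP[/mapP[q /sB ? ->]|/tB].
rewrite big_cat big_map/= scaler_sumr; congr (_ + _).
by apply: eq_bigr => p _; rewrite scalerA.
Qed.

Lemma lin_spanS B B' : B `<=` B' -> lin_span B `<=` lin_span B'.
Proof.
move=> BB'; apply: lin_span_min; first exact: subspace_lin_span.
by apply: (subset_trans BB'); apply: subset_lin_span.
Qed.

Lemma lin_span_seq t x : lin_span [set` t] x ->
  exists c : 'I_(size t) -> R[i], x = \sum_i c i *: t`_i.
Proof.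
apply: (@lin_span_min
  [set x | exists c : 'I_(size t) -> R[i], x = \sum_i c i *: t`_i]).
- split; first by exists (fun=> 0); rewrite big1// => i _; rewrite scale0r.
  move=> a _ _ [c ->] [c' ->]; exists (fun i => a * c i + c' i).
  rewrite scaler_sumr -big_split/=; apply: eq_bigr => i _.
  by rewrite scalerA -scalerDl.
- move=> y /= yt; have yi : (index y t < size t)%N by rewrite index_mem.
  exists (fun i => (i == Ordinal yi)%:R).
  rewrite (bigD1 (Ordinal yi))//= eqxx scale1r nth_index// big1 ?addr0// => i.
  by move=> /negPf ->; rewrite scale0r.
Qed.

Lemma subspace_range (A : H -> H) :
  (forall a x y, A (a *: x + y) = a *: A x + A y) -> subspace (range A).
Proof.
move=> lA; split=> [|a _ _ [x _ <-] [y _ <-]]; last by exists (a *: x + y).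
by exists 0 => //; have := lA (-1) 0 0; rewrite scaler0 addr0 scaleN1r addNr.
Qed.

End LinearSpan.

(** * Orthonormal families and dimension *)

Section Hilbert.
Context {R : realType} {H : completeNormedModType R[i]}.
Variable dot : {dot H for Num.conj}.
Hypothesis hnorm : induces_norm dot.
Implicit Types (V B : set H) (s t : seq H).

Lemma dotC x y : dot x y = (dot y x)^*%R.
Proof. by rewrite hermC expr0 mul1r. Qed.

Lemma dot_eq0C x y : dot x y = 0 -> dot y x = 0.
Proof. by rewrite dotC => /eqP; rewrite conjC_eq0 => /eqP. Qed.

Lemma dotx_eq0 x : dot x x = 0 -> x = 0.
Proof. by move/eqP; rewrite dnorm_eq0 => /eqP. Qed.

Lemma subspace_orth x : subspace [set y | dot x y = 0].
Proof.
split => /= [|a y z xy xz]; first exact: linear0r.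
by rewrite linearPr/= xy xz mulr0 addr0.
Qed.

Definition proj s x := \sum_(b <- s) dot x b *: b.

Lemma proj_in s x : lin_span [set` s] (proj s x).
Proof.
apply: subspace_sum; first exact: subspace_lin_span.
move=> b bs; apply: subspaceZ; first exact: subspace_lin_span.
exact: subset_lin_span.
Qed.

(** Expanding the [s`_i] in the [t`_j] with coefficients [A] turns the Gram
    matrix of [s], which is the identity, into a product [A *m G] through a
    space of dimension [size t]; the rank bounds [size s]. *)
Lemma orthonormal_size s t : uniq s -> orthonormal_set dot [set` s] ->
  [set` s] `<=` lin_span [set` t] -> (size s <= size t)%N.
Proof.
move=> us os st.
have /choice[c cE] : forall i : 'I_(size s), exists c : 'I_(size t) -> R[i],
    s`_i = \sum_j c j *: t`_j.
  by move=> i; apply: lin_span_seq; apply: st; apply: mem_nth.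
pose A := \matrix_(i < size s, j < size t) c i j.
pose G := \matrix_(j < size t, k < size s) dot t`_j s`_k.
have AG : A *m G = 1%:M.
  apply/matrixP => i k; rewrite !mxE.
  have -> : (i == k)%:R = dot s`_i s`_k.
    by rewrite os ?nth_uniq//=; apply: mem_nth.
  rewrite [in RHS]cE linear_sumlz; apply: eq_bigr => j _.
  by rewrite !mxE linearZl_LR.
rewrite -(mxrank1 R[i] (size s)) -AG.
exact: leq_trans (mxrankM_maxr _ _) (rank_leq_row _).
Qed.

Section Projection.
Variable s : seq H.
Hypotheses (us : uniq s) (os : orthonormal_set dot [set` s]).

Lemma proj_orth x v : lin_span [set` s] v -> dot (x - proj s x) v = 0.
Proof.
apply: (lin_span_min (subspace_orth (x - proj s x))) => b /= bs.
rewrite linearBl linear_sumlz (bigD1_seq b)//=.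
rewrite linearZl_LR/= (os bs bs) eqxx mulr1.
rewrite big_seq_cond big1 ?addr0 ?subrr// => c.
by move=> /andP[cs /negPf cb]; rewrite linearZl_LR/= (os cs bs) cb mulr0.
Qed.

(** By Pythagoras the projection is the best approximation in the span, so a
    point at distance zero from the span lies in it. *)
Lemma proj_closest x v : lin_span [set` s] v -> `|x - proj s x| <= `|x - v|.
Proof.
move=> sv; rewrite -ler_sqr ?nnegrE// !hnorm.
have -> : x - v = (x - proj s x) + (proj s x - v) by rewrite addrA subrK.
rewrite [leRHS]hnormDd ?lerDl ?dnorm_ge0//=.
apply: proj_orth; apply: subspaceB => //; first exact: subspace_lin_span.
exact: proj_in.
Qed.

Lemma closed_lin_span : closure (lin_span [set` s]) = lin_span [set` s].
Proof.
apply/seteqP; split; last exact: subset_closure.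
move=> x cx; suff -> : x = proj s x by exact: proj_in.
apply/eqP; rewrite -subr_eq0 -normr_eq0; apply/negPn/negP => n0.
have e0 : 0 < `|x - proj s x| by rewrite lt_def n0 normr_ge0.
have [v [sv]] := cx _ (nbhsx_ballx x _ e0).
rewrite -ball_normE /= => /(le_lt_trans (proj_closest x sv)).
by rewrite ltxx.
Qed.

End Projection.

(** One step of the Gram-Schmidt process: the new vector [w] is the normalized
    residual of a vector of [V] outside the span. *)
Lemma orthonormal_extend s V : uniq s -> orthonormal_set dot [set` s] ->
  subspace V -> [set` s] `<=` V -> ~ (V `<=` lin_span [set` s]) ->
  exists w, [/\ uniq (w :: s), orthonormal_set dot [set` w :: s] &
                [set` w :: s] `<=` V].
Proof.
move=> us os sV Vs nVs.
have [x Vx nx] : exists2 x, V x & ~ lin_span [set` s] x.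
  by apply: contra_notP nVs => /forall2NP h x; case: (h x) => // /contrapT.
pose u := x - proj s x.
have u0 : u != 0.
  by rewrite subr_eq0; apply: contra_not_neq nx => ->; exact: proj_in.
pose w := `|u|^-1 *: u.
have ww : dot w w = 1.
  rewrite dnormZ -hnorm ger0_norm ?invr_ge0// -exprMn mulVf ?expr1n//.
  by rewrite normr_eq0.
have wb b : b \in s -> dot w b = 0.
  move=> bs; rewrite linearZl_LR/= proj_orth ?mulr0//.
  exact: subset_lin_span.
have ws : w \notin s.
  by apply/negP => /wb; rewrite ww => /eqP; rewrite oner_eq0.
exists w; split; first by rewrite /= ws.
- move=> y z /=; rewrite !inE => /predU1P[->|ys] /predU1P[->|zs].
  + by rewrite eqxx.
  + by rewrite wb//; case: eqP => // E; rewrite E zs in ws.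
  + by rewrite dot_eq0C ?wb//; case: eqP => // E; rewrite -E ys in ws.
  + exact: os.
- move=> y /=; rewrite inE => /predU1P[->|/Vs//].
  apply: subspaceZ => //; apply: subspaceB => //.
  by apply: (lin_span_min sV Vs); exact: proj_in.
Qed.

(** If no orthonormal family spanned [V], then every family in [V] could be
    extended, against the bound [orthonormal_size]. *)
Lemma orthonormal_exists V t : subspace V -> V `<=` lin_span [set` t] ->
  exists s, [/\ uniq s, orthonormal_set dot [set` s] & lin_span [set` s] = V].
Proof.
move=> sV Vt; apply: contrapT => nex.
have grow k : exists s, [/\ uniq s, orthonormal_set dot [set` s],
    [set` s] `<=` V & size s = k].
  elim: k => [|k [s [us os Vs <-]]]; first by exists [::].
  have [|w [uw ow Vw]] := @orthonormal_extend s V us os sV Vs; last first.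
    by exists (w :: s).
  move=> sub; apply: nex; exists s; split=> //; apply/seteqP; split=> //.
  exact: lin_span_min.
have [s [us os Vs szs]] := grow (size t).+1.
have := orthonormal_size us os (subset_trans Vs Vt).
by rewrite szs ltnn.
Qed.

(** The dimension is defined from a chosen basis, about which only its defining
    property is known; [orthonormal_size], used in both directions, shows that
    the choice does not affect the number of elements. *)
Lemma hdim_lin_span s : uniq s -> orthonormal_set dot [set` s] ->
  hdim dot (lin_span [set` s]) = (size s)%:R%:E.
Proof.
move=> us os; rewrite /hdim.
have := @xgetPex _ set0 (orthonormal_basis dot (lin_span [set` s])).
case; first by exists [set` s]; split=> //; exact: closed_lin_span.
set B := xget _ _ => oB cB.
have BV : B `<=` lin_span [set` s].
  rewrite -cB; apply: subset_trans (@subset_closure _ _).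
  exact: subset_lin_span.
have Bfin : finite_set B.
  apply: contrapT => /(infinite_set_fset (size s).+1)[F FB].
  rewrite ltnNge (@orthonormal_size (enum_fset F) s)//.
  - exact: fset_uniq.
  - by move=> x y /FB Bx /FB By; exact: oB.
  - exact: subset_trans BV.
rewrite /counting asboolT//; congr (_%:R%:E).
have FB : [set` fset_set B] = B by exact: fset_setK.
have oF : orthonormal_set dot [set` fset_set B] by rewrite FB.
have uF := fset_uniq (fset_set B).
apply/eqP; rewrite eqn_leq; apply/andP; split.
  by apply: orthonormal_size => //; rewrite FB.
apply: orthonormal_size => //; rewrite -closed_lin_span// FB cB.
exact: subset_lin_span.
Qed.

(** A positive dimension certifies that the chosen set is a genuine orthonormal
    basis, since the default choice is the empty set. *)
Lemma hdim_finite V : (0 < hdim dot V)%E -> (hdim dot V < +oo)%E ->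
  exists t, V = lin_span [set` t].
Proof.
rewrite /hdim; case: xgetP => [B -> [oB cB] _|_]; last first.
  by rewrite /counting asboolT// fset_set0/= ltxx.
set B' := xget _ _ in oB cB *.
rewrite /counting; case: asboolP => [Bfin _|_]; last by rewrite ltxx.
have FB : [set` fset_set B'] = B' by exact: fset_setK.
exists (fset_set B'); rewrite -closed_lin_span ?FB//.
exact: fset_uniq.
Qed.

(** An orthonormal basis of [V] extends inside [W] by one more vector. *)
Lemma hdim_ltP V W t : subspace V -> subspace W -> V `<=` W ->
  W `<=` lin_span [set` t] -> ~ (W `<=` V) -> (hdim dot V < hdim dot W)%E.
Proof.
move=> sV sW VW Wt nWV.
have [s [us os Vs]] := orthonormal_exists sV (subset_trans VW Wt).
have [r [ur or Wr]] := orthonormal_exists sW Wt.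
have s_sub_W : [set` s] `<=` W.
  by apply: subset_trans VW; rewrite -Vs; exact: subset_lin_span.
have [|w [uw ow ww]] := @orthonormal_extend s W us os sW s_sub_W.
  by rewrite Vs.
rewrite -Vs -Wr !hdim_lin_span// lte_fin ltr_nat.
by apply: (orthonormal_size uw ow); rewrite Wr.
Qed.

(** * Symmetric and positive operators *)

Definition symmetric_op (A : H -> H) := forall x y, dot (A x) y = dot x (A y).
Definition positive_op (A : H -> H) := forall x, 0 <= dot (A x) x.

(** Symmetry alone forces linearity, because the form separates points; this
    spares a separate proof that the adjoints are linear. *)
Lemma symmetric_linear A : symmetric_op A ->
  forall a x y, A (a *: x + y) = a *: A x + A y.
Proof.
move=> sA a x y; apply/eqP; rewrite -subr_eq0; apply/eqP/dotx_eq0.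
set z := (X in dot _ X).
by rewrite linearBl/= sA !linearPl/= !sA subrr.
Qed.

Lemma symmetric0 A : symmetric_op A -> A 0 = 0.
Proof. by move=> sA; apply: dotx_eq0; rewrite sA linear0l. Qed.

(** The Cauchy-Schwarz argument for the semi-inner product
    [(x, y) |-> dot (A x) y]: if [A x] were nonzero, the nonnegative function
    [t |-> dot (A (x + t *: A x)) (x + t *: A x)], which vanishes at [0] with
    slope [2 * dot (A x) (A x)], would be negative at some [t < 0]. *)
Lemma positive_eq0 A x : symmetric_op A -> positive_op A ->
  dot (A x) x = 0 -> A x = 0.
Proof.
move=> sA pA Axx; apply: dotx_eq0; set a := dot _ _.
have lA := symmetric_linear sA.
pose c := dot (A (A x)) (A x).
have a0 : 0 <= a by exact: dnorm_ge0.
have c0 : 0 <= c by exact: pA.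
have c1 : 0 < c + 1 by rewrite ltr_wpDl.
(* The quadratic [t ^+ 2 * c + 2 * t * a] is least at [t = - a / c]; adding [1]
   keeps the denominator positive when [c = 0]. *)
have [t tE] : exists t : R[i], t = - a / (c + 1) by eexists.
have tr : t^*%R = t.
  by apply: conj_Creal; rewrite tE realM ?realV ?realN ?ger0_real// ltW.
have := pA (t *: A x + x).
have AAx : dot (A (A x)) x = a by rewrite sA.
rewrite lA linearPl/= !linearPr/= tr Axx AAx -/a -/c addr0 -[t *: _]/(t * _).
rewrite (_ : _ + _ = - (a ^+ 2 * (c + 2) / (c + 1) ^+ 2)); last first.
  by rewrite tE; field; rewrite gt_eqF.
rewrite oppr_ge0 pmulr_lle0 ?invr_gt0 ?exprn_gt0// pmulr_lle0; last first.
  by rewrite ltr_wpDl.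
move=> a2; apply/eqP; rewrite -sqrf_eq0 eq_le a2/=.
exact: exprn_ge0.
Qed.

Definition has_adjoint (A : H -> H) :=
  forall x y, dot (A x) y = dot x (adjoint dot A y).

(** The adjoint is a choice among the maps satisfying the adjoint identity,
    with default value [0].  Splitting on which value was chosen stands in for
    the Riesz representation theorem: if no map satisfied the identity, then
    [A X A^*] would vanish for every linear [X], and it would contribute
    nothing to [P_T (X)]. *)
Lemma adjointP (A : H -> H) : has_adjoint A \/ adjoint dot A = fun=> 0.
Proof.
by rewrite /has_adjoint /adjoint; case: xgetP => [B _ hB|_]; [left|right].
Qed.

Lemma adjoint_dot (A : H -> H) : has_adjoint A -> forall x y,
  dot (adjoint dot A x) y = dot x (A y).
Proof. by move=> hA x y; rewrite dotC -hA -dotC. Qed.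

Lemma symmetric_conj (A : {linear H -> H}) (X : H -> H) : symmetric_op X ->
  symmetric_op (fun x => A (X (adjoint dot A x))).
Proof.
move=> sX x y; case: (adjointP A) => [hA|->].
  by rewrite hA sX adjoint_dot.
by rewrite symmetric0// linear0 linear0l linear0r.
Qed.

Lemma positive_conj (A : {linear H -> H}) (X : H -> H) :
  symmetric_op X -> positive_op X ->
  positive_op (fun x => A (X (adjoint dot A x))).
Proof.
move=> sX pX x; case: (adjointP A) => [hA|->]; first by rewrite hA.
by rewrite symmetric0// linear0 linear0l.
Qed.

(** A range of finite dimension has an orthonormal basis, hence a projection of
    [z] onto it; the residual is orthogonal to the range, that is, it lies in
    the kernel, to which [z] is orthogonal as well. *)
Lemma range_symmetric (A : H -> H) t z : symmetric_op A ->
  range A `<=` lin_span [set` t] ->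
  (forall x, A x = 0 -> dot z x = 0) -> range A z.
Proof.
move=> sA At zA.
have [s [us os As]] :=
  orthonormal_exists (subspace_range (symmetric_linear sA)) At.
pose w := z - proj s z.
have wA v : range A v -> dot w v = 0 by rewrite -As; exact: proj_orth.
have Aw : A w = 0 by apply: dotx_eq0; rewrite sA; apply: wA; exists (A w).
have w0 : w = 0.
  apply: dotx_eq0; rewrite {1}/w linearBl/= zA// sub0r.
  by rewrite dot_eq0C ?oppr0//; apply: wA; rewrite -As; exact: proj_in.
by rewrite -As (subr0_eq w0); exact: proj_in.
Qed.

(** * Ranges of the defect operators *)

Section Tuple.
Context {d : nat}.
Variable T : 'I_d -> {linear H -> H}.
Hypothesis hcontr : contractive dot T.

Definition defect_op n x := x - tuple_iter dot T n x.

Lemma defect_op0 x : defect_op 0 x = 0.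
Proof. exact: subrr. Qed.

Lemma defect_opS n x : defect_op n.+1 x =
  defect_op 1 x + \sum_i T i (defect_op n (adjoint dot (T i) x)).
Proof.
rewrite /defect_op /tuple_iter /= {1}/tuple_map -addrA; congr (_ + _).
rewrite /tuple_map -sumrN -sumrN -big_split/=; apply: eq_bigr => i _.
by rewrite linearB/= addrA addNr sub0r.
Qed.

Lemma tuple_iter_symmetric n : symmetric_op (tuple_iter dot T n).
Proof.
elim: n => [//|n IH] x y; rewrite /tuple_iter/= /tuple_map.
rewrite linear_sumlz linear_sumr; apply: eq_bigr => i _.
exact: (symmetric_conj (T i) IH).
Qed.

Lemma defect_op_symmetric n : symmetric_op (defect_op n).
Proof.
by move=> x y; rewrite linearBl/= linearBr/= tuple_iter_symmetric.
Qed.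

Lemma defect_op_positive n : positive_op (defect_op n).
Proof.
elim: n => [|n IH] x; first by rewrite defect_op0 linear0l.
rewrite defect_opS linearDl/= addr_ge0//; first exact: hcontr.
rewrite linear_sumlz sumr_ge0// => i _.
exact: (positive_conj (T i) (@defect_op_symmetric n) IH).
Qed.

Lemma subspace_defect n : subspace (range (defect_op n)).
Proof.
by apply: subspace_range; apply: symmetric_linear; exact: defect_op_symmetric.
Qed.

(** This is the inclusion [R_(n+1) <= R_1 + \sum_i T_i R_n], where the sum is
    represented by the subspaces [W] that contain all its terms. *)
Lemma defectS_sub n W : subspace W -> range (defect_op 1) `<=` W ->
  (forall i, has_adjoint (T i) ->
     forall y, range (defect_op n) y -> W (T i y)) ->
  range (defect_op n.+1) `<=` W.
Proof.
move=> sW W1 WT _ [x _ <-]; rewrite defect_opS.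
apply: subspaceD => //; first by apply: W1; exists x.
apply: subspace_sum => // i _; case: (adjointP (T i)) => [hi|->].
  by apply: WT => //; eexists.
by rewrite symmetric0 ?linear0; [exact: sW.1|exact: defect_op_symmetric].
Qed.

Section FiniteRank.
Variable t1 : seq H.
Hypothesis fin1 : range (defect_op 1) `<=` lin_span [set` t1].

Lemma defect_finite n : exists t, range (defect_op n) `<=` lin_span [set` t].
Proof.
elim: n => [|n [t IH]].
  exists [::] => _ [x _ <-]; rewrite defect_op0.
  exact: (subspace_lin_span _).1.
pose u := t1 ++ [seq T i x | i <- enum 'I_d, x <- t]; exists u.
apply: defectS_sub; first exact: subspace_lin_span.
  apply: (subset_trans fin1); apply: lin_spanS => x /=.
  by rewrite mem_cat => ->.
move=> i _ y /IH.
have : subspace [set y | lin_span [set` u] (T i y)].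
  have su := subspace_lin_span [set` u].
  split=> /= [|a x z ? ?]; first by rewrite linear0; exact: su.1.
  by rewrite linearP; exact: su.2.
move/lin_span_min; apply => x /= xt; apply: subset_lin_span => /=.
by rewrite mem_cat (allpairs_f _ (mem_enum _ i) xt) orbT.
Qed.

(** The recursion writes [dot (D_(n+1) x) x] as the sum of [dot (D_1 x) x] and
    of the [dot (D_n (T_i^* x)) (T_i^* x)], all nonnegative; if it vanishes, then
    so does each of them, and [positive_eq0] applies. *)
Lemma defect_op_eq0 n x : defect_op n.+1 x = 0 ->
  defect_op 1 x = 0 /\
  forall i, has_adjoint (T i) -> defect_op n (adjoint dot (T i) x) = 0.
Proof.
move=> Dx.
have pos i := positive_conj (T i) (@defect_op_symmetric n)
  (@defect_op_positive n) x.
have : dot (defect_op n.+1 x) x == 0 by rewrite Dx linear0l.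
rewrite defect_opS linearDl/= linear_sumlz paddr_eq0; first last.
- by apply: sumr_ge0 => i _; exact: pos.
- exact: defect_op_positive.
move=> /andP[/eqP D1 /eqP DT]; split.
  exact: positive_eq0 (@defect_op_symmetric 1) (@defect_op_positive 1) D1.
move=> i hi.
apply: positive_eq0 (@defect_op_symmetric n) (@defect_op_positive n) _.
by rewrite -hi; exact: (psumr_eq0P (fun i _ => pos i) DT).
Qed.

Lemma defect1_sub n : range (defect_op 1) `<=` range (defect_op n.+1).
Proof.
move=> _ [y _ <-]; have [t Ht] := defect_finite n.+1.
apply: (range_symmetric (@defect_op_symmetric _) Ht) => x /defect_op_eq0[D1 _].
by rewrite defect_op_symmetric D1 linear0r.
Qed.

Lemma defect_T_sub n i y : has_adjoint (T i) ->
  range (defect_op n) y -> range (defect_op n.+1) (T i y).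
Proof.
move=> hi [z _ <-]; have [t Ht] := defect_finite n.+1.
apply: (range_symmetric (@defect_op_symmetric _) Ht) => x /defect_op_eq0[_ DT].
by rewrite hi defect_op_symmetric DT// linear0r.
Qed.

Lemma defect_mono n : range (defect_op n) `<=` range (defect_op n.+1).
Proof.
elim: n => [|n IH].
  by move=> _ [x _ <-]; rewrite defect_op0; exact: (subspace_defect 1).1.
apply: defectS_sub; [exact: subspace_defect|exact: defect1_sub|].
by move=> i hi y /IH; exact: defect_T_sub.
Qed.

(** If [R_(n+1) <= R_n] then [R_n] contains [R_1] and is invariant under each
    [T_i], hence it contains every [R_m] by the recursion. *)
Lemma defect_stationary n m : range (defect_op n.+1) `<=` range (defect_op n) ->
  range (defect_op m) `<=` range (defect_op n).
Proof.
move=> stat; elim: m => [|m IH].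
  by move=> _ [x _ <-]; rewrite defect_op0; exact: (subspace_defect n).1.
apply: defectS_sub; first exact: subspace_defect.
  by apply: subset_trans stat; exact: defect1_sub.
by move=> i hi y /IH yn; apply/stat/defect_T_sub.
Qed.

Lemma closed_defect n : closure (range (defect_op n)) = range (defect_op n).
Proof.
have [t Ht] := defect_finite n.
have [s [us os <-]] := orthonormal_exists (subspace_defect n) Ht.
exact: closed_lin_span.
Qed.

Lemma pure_stationary n : pure dot T ->
  range (defect_op n.+1) `<=` range (defect_op n) -> range (defect_op n) = setT.
Proof.
move=> hp stat; apply/seteqP; split=> // x _; rewrite -closed_defect.
have cx : defect_op m x @[m --> \oo] --> x.
  by rewrite -[X in _ --> X]subr0; apply: cvgB (hp x); exact: cvg_cst.
apply: (closed_cvg (closure (range (defect_op n))) _ _ _ cx).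
  exact: closed_closure.
apply: nearW => m; apply: subset_closure.
by apply: (defect_stationary stat); exists x.
Qed.

End FiniteRank.
End Tuple.
End Hilbert.

(** * Strict growth of the defect dimensions *)

Theorem lemma2p5 (R : realType) (H : completeNormedModType R[i]%C)
    (dot : {dot H for Num.conj}%R)
    (hnorm : induces_norm dot)
    (hsep : separable_space (H := H))
    (hinf : hdim dot [set: H]%classic = +oo%E)
    (d : nat) (hd : (0 < d)%N)
    (T : 'I_d -> {linear H -> H}%R)
    (hT : forall i, bounded_op (T i))
    (hcontr : contractive dot T)
    (hdim_pos : (0 < defect_dim dot T 1)%E)
    (hdim_fin : (defect_dim dot T 1 < +oo)%E)
    (hpure : pure dot T) :
  forall n : nat, (1 <= n)%N ->
    (defect_dim dot T n < defect_dim dot T n.+1)%E.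
Proof.
move=> n _; have [t1 V1] := hdim_finite hnorm hdim_pos hdim_fin.
have fin1 : range (defect_op dot T 1) `<=` lin_span [set` t1].
  by rewrite -V1; exact: subset_closure.
rewrite /defect_dim /defect_space.
have clE m := closed_defect hnorm fin1 m.
rewrite (clE n) (clE n.+1).
have [t Ht] := defect_finite fin1 n.+1.
apply: (hdim_ltP hnorm (subspace_defect _ _ _) (subspace_defect _ _ _) _ Ht).
  exact: defect_mono fin1 _.
move=> /(pure_stationary hnorm hcontr fin1 hpure) RT.
have [r Hr] := defect_finite fin1 n.
have [s [us os sV]] := orthonormal_exists hnorm (subspace_defect _ _ _) Hr.
by move: hinf; rewrite -RT -sV (hdim_lin_span hnorm us os).
Qed.
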